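(* Every body of constant width in $\mathbb{H}^d$ is reduced.
   Context: $\mathbb{H}^d$ is the $d$-dimensional hyperbolic space, and $|ab|$ is the hyperbolic distance of points $a,b$. A set is convex if with every two points it contains the geodesic segment joining them. A convex body in $\mathbb{H}^d$ is a closed bounded convex set with non-empty interior. A hyperplane $H$ supports a convex body $C$ if $H$ has a common point with $C$ and $H$ is disjoint from the interior of $C$. For non-empty sets $A,B$, $\mathrm{dist}(A,B)$ is the infimum of $|ab|$ over $a\in A$, $b\in B$. Two hyperplanes are ultraparallel if they do not intersect in a real or imaginary point (that is, they meet neither in $\mathbb{H}^d$ nor at infinity). For a hyperplane $H$ supporting a convex body $C$, the width $\mathrm{width}_H(C)$ of $C$ determined by $H$ is the distance $\mathrm{dist}(H,J)$ between $H$ and any farthest (from $H$) hyperplane $J$ among those ultraparallel to $H$ and supporting $C$. The thickness $\Delta(C)$ is the infimum of $\mathrm{width}_H(C)$ over all hyperplanes $H$ supporting $C$. A convex body $W$ is a body of constant width if there is a $\delta$ such that $\mathrm{width}_H(W)=\delta$ for every hyperplane $H$ supporting $W$. A convex body $R$ is reduced if $\Delta(Z)<\Delta(R)$ for every convex body $Z\subset R$ different from $R$. *)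

(* Defs.v *)
From HB Require Import structures.
From mathcomp Require Import all_boot all_order all_algebra.
From mathcomp Require Import ring lra.
From mathcomp Require Import all_classical all_reals all_analysis.

Set Implicit Arguments.
Unset Strict Implicit.
Unset Printing Implicit Defensive.

Import Order.TTheory GRing.Theory Num.Theory.
Local Open Scope classical_set_scope.
Local Open Scope ring_scope.

(* Lorentz form of the hyperboloid model; the time-like coordinate is [ord0]. *)
Definition lform (R : realType) (d : nat) (u v : 'rV[R]_d.+1) : R :=
  \sum_(i < d) u 0 (lift ord0 i) * v 0 (lift ord0 i) - u 0 ord0 * v 0 ord0.

Record hyperbolic (R : realType) (d : nat) := Hyperbolic {
  hcoord :> 'rV[R]_d.+1 ;
  hcoordP : (lform hcoord hcoord == -1) && (0 < hcoord 0 ord0) }.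

HB.instance Definition _ (R : realType) (d : nat) :=
  [isSub of hyperbolic R d for @hcoord R d].
HB.instance Definition _ (R : realType) (d : nat) :=
  [Choice of hyperbolic R d by <:].

(* The inverse of cosh on [0, +oo[; meaningful for t >= 1. *)
Definition arcosh (R : realType) (t : R) : R :=
  ln (t + Num.sqrt (t ^+ 2 - 1)).

Definition hdist (R : realType) (d : nat) (x y : hyperbolic R d) : R :=
  arcosh (- lform x y).

Section HyperbolicMetric.
Variables (R : realType) (d : nat).
Implicit Types (u v w : 'rV[R]_d.+1) (x y z : hyperbolic R d).

Lemma lformC u v : lform u v = lform v u.
Proof.
rewrite /lform [u 0 ord0 * _]mulrC; congr (_ - _).
by apply: eq_bigr => i _; rewrite mulrC.
Qed.

Lemma lform_lin (s t : R) u v w :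
  lform (s *: u + t *: v) w = s * lform u w + t * lform v w.
Proof.
rewrite /lform !mxE !mulrBr !mulr_sumr.
rewrite (eq_bigr (fun i : 'I_d => s * (u 0 (lift ord0 i) * w 0 (lift ord0 i)) +
  t * (v 0 (lift ord0 i) * w 0 (lift ord0 i)))); last first.
  by move=> i _; rewrite !mxE; ring.
by rewrite big_split /=; ring.
Qed.

Lemma psd_disc (A B C : R) :
  (forall s t : R, 0 <= A * s ^+ 2 + B * (s * t) *+ 2 + C * t ^+ 2) ->
  B ^+ 2 <= A * C.
Proof.
move=> P; have := P 0 1; have := P C (- B); have := P B (- ((A + 1) / 2)).
have [->|C0] := eqVneq C 0; first by nra.
move=> _ h2 h1; have {h1}C1 : 0 < C by rewrite lt0r C0; nra.
by rewrite -subr_ge0 -(pmulr_rge0 _ C1); nra.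
Qed.

Lemma space_cs u v :
  (\sum_(i < d) u 0 (lift ord0 i) * v 0 (lift ord0 i)) ^+ 2 <=
  (\sum_(i < d) u 0 (lift ord0 i) * u 0 (lift ord0 i)) *
  (\sum_(i < d) v 0 (lift ord0 i) * v 0 (lift ord0 i)).
Proof.
apply: psd_disc => s t.
have : 0 <= \sum_(i < d)
    (s * u 0 (lift ord0 i) + t * v 0 (lift ord0 i)) ^+ 2.
  by apply: sumr_ge0 => i _; exact: sqr_ge0.
rewrite (eq_bigr (fun i : 'I_d =>
  s ^+ 2 * (u 0 (lift ord0 i) * u 0 (lift ord0 i)) +
  (s * t *+ 2) * (u 0 (lift ord0 i) * v 0 (lift ord0 i)) +
  t ^+ 2 * (v 0 (lift ord0 i) * v 0 (lift ord0 i)))); last first.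
  by move=> i _; ring.
rewrite !big_split /= -!mulr_sumr => h; apply: le_trans h _.
by rewrite le_eqVlt; apply/orP; left; apply/eqP; ring.
Qed.

Lemma space_ge0 u : 0 <= \sum_(i < d) u 0 (lift ord0 i) * u 0 (lift ord0 i).
Proof. by apply: sumr_ge0 => i _; rewrite -expr2 sqr_ge0. Qed.

Lemma hformxx x : lform x x = -1.
Proof. by case/andP: (hcoordP x) => /eqP. Qed.

Lemma hcoord_gt0 x : 0 < x 0 ord0.
Proof. by case/andP: (hcoordP x). Qed.

Lemma ortho_ge0 x u : lform u x = 0 -> 0 <= lform u u.
Proof.
have := hformxx x; have := hcoord_gt0 x; have := space_cs u x.
have := space_ge0 u; have := space_ge0 x; rewrite /lform.
move: (\sum_i _) (\sum_i _) (\sum_i _) => UX U X.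
move: (u 0 ord0) (x 0 ord0) => a b X0 U0 cs b0 xx ux.
have e1 : X = b ^+ 2 - 1 by lra.
have e2 : UX = a * b by lra.
rewrite e1 e2 in cs X0; rewrite -(pmulr_rge0 _ (exprn_gt0 2 b0)); nra.
Qed.

Lemma ortho_eq0 x u : lform u x = 0 -> lform u u = 0 -> u = 0.
Proof.
move=> ux uu; suff [u0 us] : u 0 ord0 = 0 /\
    \sum_(i < d) u 0 (lift ord0 i) * u 0 (lift ord0 i) = 0.
  have /psumr_eq0P us0 : forall i : 'I_d, true ->
      0 <= u 0 (lift ord0 i) * u 0 (lift ord0 i).
    by move=> i _; rewrite -expr2 sqr_ge0.
  apply/rowP => i; rewrite mxE; case: (unliftP ord0 i) => [j|] -> //.
  by have /eqP := us0 us j isT; rewrite mulf_eq0 orbb => /eqP.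
move: ux uu; have := hformxx x; have := hcoord_gt0 x; have := space_cs u x.
rewrite /lform; move: (\sum_i _) (\sum_i _) (\sum_i _) => X U UX.
move: (u 0 ord0) (x 0 ord0) => a b cs b0 xx ux uu.
have e1 : X = b ^+ 2 - 1 by lra.
have e2 : UX = a * b by lra.
have e3 : U = a ^+ 2 by lra.
rewrite e1 e2 e3 in cs *; suff a0 : a ^+ 2 = 0.
  by split => //; apply/eqP; rewrite -sqrf_eq0 a0.
by nra.
Qed.

Lemma ortho_cs x u v : lform u x = 0 -> lform v x = 0 ->
  lform u v ^+ 2 <= lform u u * lform v v.
Proof.
move=> ux vx; apply: psd_disc => s t.
have := @ortho_ge0 x (s *: u + t *: v); rewrite lform_lin ux vx.
rewrite !mulr0 addr0 => /(_ erefl); rewrite lform_lin.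
rewrite ![lform _ (_ + _)]lformC !lform_lin (lformC v u) => h.
by apply: le_trans h _; rewrite le_eqVlt; apply/orP; left; apply/eqP; ring.
Qed.

(* [hproj x y] is the component of [y] orthogonal to [x]. *)
Definition hproj x y : 'rV[R]_d.+1 :=
  (1 : R) *: (y : 'rV_d.+1) + lform y x *: (x : 'rV_d.+1).

Lemma hprojo x y : lform (hproj x y) x = 0.
Proof. by rewrite lform_lin hformxx; ring. Qed.

Lemma hprojE x y z :
  lform (hproj x y) (hproj x z) = lform y z + lform y x * lform z x.
Proof.
rewrite lform_lin ![lform _ (hproj _ _)]lformC !lform_lin hformxx.
by rewrite (lformC z y) (lformC x y); ring.
Qed.

Lemma hform_le x y : 1 <= - lform x y.
Proof.
have h : 1 <= lform x y ^+ 2.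
  by have := ortho_ge0 (hprojo y x); rewrite hprojE hformxx => ?; nra.
suff : 0 < - lform x y by nra.
have := hformxx x; have := hformxx y; have := hcoord_gt0 x.
have := hcoord_gt0 y; have := space_cs x y.
have := space_ge0 y; have := space_ge0 x; rewrite /lform.
move: (\sum_i _) (\sum_i _) (\sum_i _) => XY Y X.
move: (x 0 ord0) (y 0 ord0) => a b X0 Y0 cs b0 a0 yy xx.
have ab : 0 < a * b by exact: mulr_gt0.
have e1 : X = a ^+ 2 - 1 by lra.
have e2 : Y = b ^+ 2 - 1 by lra.
rewrite e1 e2 in cs X0 Y0.
have {}cs : XY ^+ 2 < (a * b) ^+ 2 by nra.
suff : XY < a * b by lra.
by rewrite ltNge; apply/negP => le; nra.
Qed.

Lemma arcosh1 : arcosh (1 : R) = 0.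
Proof. by rewrite /arcosh expr1n subrr sqrtr0 addr0 ln1. Qed.

Lemma arcosh_le (p q : R) : 1 <= p -> p <= q -> arcosh p <= arcosh q.
Proof.
move=> p1 pq; have := sqrtr_ge0 (p ^+ 2 - 1); have := sqrtr_ge0 (q ^+ 2 - 1).
move=> Q0 P0; rewrite /arcosh ler_ln ?posrE; try lra.
by rewrite lerD // ler_sqrt; nra.
Qed.

Lemma arcosh_eq0 (p : R) : 1 <= p -> arcosh p = 0 -> p = 1.
Proof.
move=> p1; have P0 := sqrtr_ge0 (p ^+ 2 - 1); rewrite /arcosh => /eqP.
by rewrite ln_eq0; [move/eqP; lra|lra].
Qed.

Lemma arcoshD (p q : R) : 1 <= p -> 1 <= q ->
  arcosh (p * q + Num.sqrt (p ^+ 2 - 1) * Num.sqrt (q ^+ 2 - 1)) =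
  arcosh p + arcosh q.
Proof.
move=> p1 q1; rewrite /arcosh.
have P0 := sqrtr_ge0 (p ^+ 2 - 1); have Q0 := sqrtr_ge0 (q ^+ 2 - 1).
have : Num.sqrt (p ^+ 2 - 1) ^+ 2 = p ^+ 2 - 1 by rewrite sqr_sqrtr //; nra.
have : Num.sqrt (q ^+ 2 - 1) ^+ 2 = q ^+ 2 - 1 by rewrite sqr_sqrtr //; nra.
move: (Num.sqrt _) (Num.sqrt _) P0 Q0 => Q P P0 Q0 eQ eP.
rewrite -lnM ?posrE; try lra; congr ln.
have -> : (p * q + P * Q) ^+ 2 - 1 = (p * Q + q * P) ^+ 2.
  have -> : 1 = (p ^+ 2 - P ^+ 2) * (q ^+ 2 - Q ^+ 2).
    by rewrite eP eQ; ring.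
  by ring.
by rewrite sqrtr_sqr ger0_norm; [ring|nra].
Qed.

Lemma hdistxx x : hdist x x = 0.
Proof. by rewrite /hdist hformxx opprK arcosh1. Qed.

Lemma hdist_positivity x y : hdist x y = 0 -> x = y.
Proof.
move=> /(arcosh_eq0 (hform_le x y)) xy.
have {}xy : lform x y = -1 by lra.
have /ortho_eq0 := hprojo y x; rewrite hprojE hformxx xy => /(_ _)/eqP.
rewrite /hproj xy scale1r scaleN1r subr_eq0 => h; apply/val_inj/eqP/h; ring.
Qed.

Lemma hdist_sym x y : hdist x y = hdist y x.
Proof. by rewrite /hdist lformC. Qed.

Lemma hdist_triangle y x z : hdist x z <= hdist x y + hdist y z.
Proof.
rewrite /hdist -arcoshD ?hform_le //; apply: arcosh_le; first exact: hform_le.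
have := ortho_cs (hprojo y x) (hprojo y z); rewrite !hprojE !hformxx.
rewrite (lformC y z); move: (hform_le x y) (hform_le z y).
move: (lform x y) (lform z y) (lform x z) => p q r p1 q1 cs.
have P0 := sqrtr_ge0 ((- p) ^+ 2 - 1); have Q0 := sqrtr_ge0 ((- q) ^+ 2 - 1).
have : Num.sqrt ((- p) ^+ 2 - 1) ^+ 2 = p ^+ 2 - 1 by rewrite sqr_sqrtr //; nra.
have : Num.sqrt ((- q) ^+ 2 - 1) ^+ 2 = q ^+ 2 - 1 by rewrite sqr_sqrtr //; nra.
move: (Num.sqrt _) (Num.sqrt _) P0 Q0 => Q P P0 Q0 eQ eP.
have {}cs : (r + p * q) ^+ 2 <= (P * Q) ^+ 2.
  by rewrite exprMn eP eQ; apply: le_trans cs _; rewrite le_eqVlt; apply/orP;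
    left; apply/eqP; ring.
have PQ : 0 <= P * Q by exact: mulr_ge0.
suff : - (r + p * q) <= P * Q by lra.
by rewrite leNgt; apply/negP => lt; nra.
Qed.

End HyperbolicMetric.

HB.instance Definition _ (R : realType) (d : nat) :=
  isMetric.Build R (hyperbolic R d) (@hdistxx R d) (@hdist_positivity R d)
    (@hdist_sym R d) (@hdist_triangle R d).

Section Bodies.
Variables (R : realType) (d : nat).
Local Notation hyp := (hyperbolic R d).
Implicit Types (A B C : set hyp) (a b : hyp).

Definition setdist A B : R := inf [set mdist a b | a in A & b in B].

Definition metric_bounded C : Prop :=
  exists M : R, forall a b, C a -> C b -> mdist a b <= M.

Definition geodesic a b (g : R -> hyp) : Prop :=
  [/\ g 0 = a, g (mdist a b) = b &
    forall s t : R, 0 <= s <= mdist a b -> 0 <= t <= mdist a b ->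
      mdist (g s) (g t) = `|s - t|].

Definition geodesic_segment a b : set hyp :=
  [set c | exists g : R -> hyp, geodesic a b g /\
     exists2 t : R, 0 <= t <= mdist a b & g t = c].

Definition convex C : Prop :=
  forall a b, C a -> C b -> geodesic_segment a b `<=` C.

Definition convex_body C : Prop :=
  [/\ closed C, metric_bounded C, convex C & C° !=set0].

(* A hyperplane is given by a space-like normal vector; proportional normals
   give the same set of points. *)
Record hyperplane := Hyperplane {
  normal : 'rV[R]_d.+1 ;
  normal_gt0 : 0 < lform normal normal }.
Implicit Types H J : hyperplane.

Definition points H : set hyp := [set x | lform x (normal H) = 0].

(* A point at infinity is the line spanned by a nonzero light-like vector. *)
Definition ideal_points H : set 'rV[R]_d.+1 :=
  [set u | [/\ u != 0, lform u u = 0 & lform u (normal H) = 0]].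

Definition ultraparallel H J : Prop :=
  points H `&` points J = set0 /\ ideal_points H `&` ideal_points J = set0.

Definition supports H C : Prop :=
  points H `&` C !=set0 /\ points H `&` C° = set0.

Definition farthest H C : set hyperplane :=
  [set J | [/\ ultraparallel H J, supports J C &
    forall J', ultraparallel H J' -> supports J' C ->
      setdist (points H) (points J') <= setdist (points H) (points J)]].

(* All farthest hyperplanes are at the same distance from H, so the set below
   has at most one element; the default 0 is used only if there is none. *)
Definition width H C : R :=
  xget 0 [set setdist (points H) (points J) | J in farthest H C].

Definition thickness C : R :=
  inf [set width H C | H in [set H | supports H C]].

Definition constant_width C : Prop :=
  convex_body C /\ exists delta : R, forall H, supports H C -> width H C = delta.

Definition reduced C : Prop :=
  convex_body C /\ forall Z : set hyp,
    convex_body Z -> Z `<=` C -> Z <> C -> thickness Z < thickness C.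

End Bodies.

(* Main.v *)
Require Import Defs.
From mathcomp Require Import all_boot all_order all_algebra.
From mathcomp Require Import ring lra.
From mathcomp Require Import all_classical all_reals all_analysis.

Set Implicit Arguments.
Unset Strict Implicit.
Unset Printing Implicit Defensive.

Import Order.TTheory GRing.Theory Num.Theory.
Import numFieldNormedType.Exports.
Local Open Scope classical_set_scope.
Local Open Scope ring_scope.

(** Write <x, y> for the Lorentz form. A hyperplane H supporting a body C has
    a unit normal n with <x, n> >= 0 on C, and the distance from x to H is the
    inverse hyperbolic sine of the height <x, n>. Let p be a highest point of
    C, at height s. The vector n + s p is normal to the hyperplane J through p
    that is perpendicular to the shortest segment from p to H, and for x in C
      <x, n + s p> = <x, n> + s <x, p> <= s - s = 0
    because <x, p> <= -1. So J supports C, it is ultraparallel to H, and it is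
    as far from H as p is; no supporting hyperplane is farther, since it
    contains a point of C. Hence the width of C at H is the distance from H to
    its farthest point ([width_height]): a width is determined by the maximum
    over C of a linear form.

    Let W have constant width, so that the maximal height s is the same for all
    supporting hyperplanes, and let H touch W at q. The height of q over J is at
    most s, which says that q is no farther from p than H is. Then q is the
    foot of the perpendicular from p to H ([constant_width_chord]).
    Exchanging H and J, every point of W at maximal height over J is the foot
    of the perpendicular from p to H, that is, q
    ([constant_width_opposite]).

    Let Z be a body properly contained in W. Separate some point of W from Z by
    a hyperplane, and move that hyperplane away from Z along a perpendicular
    geodesic until it leaves W: this yields a hyperplane H supporting W at a
    point e outside Z ([separation], [pencil_support]). With J the opposite
    hyperplane of H, all points of Z have height less than s over J, because e
    is the only point of W at height s. Now move J along the perpendicular at p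
    towards Z until it touches Z. This does not increase the heights of the
    points of Z, so the width of Z at the resulting hyperplane is less than the
    width of W. *)

(** * The Lorentz form on vectors and on points *)

Section LorentzForm.
Variables (R : realType) (d : nat).
Implicit Types (u v w : 'rV[R]_d.+1) (x y z : hyperbolic R d) (s t : R).

Lemma lformDl u v w : lform (u + v) w = lform u w + lform v w.
Proof. by have := lform_lin 1 1 u v w; rewrite !scale1r !mul1r. Qed.

Lemma lformZl s u w : lform (s *: u) w = s * lform u w.
Proof. by have := lform_lin s 0 u u w; rewrite scale0r addr0 mul0r addr0. Qed.

Lemma lformDr u v w : lform w (u + v) = lform w u + lform w v.
Proof. by rewrite lformC lformDl !(lformC _ w). Qed.

Lemma lformZr s u w : lform w (s *: u) = s * lform w u.
Proof. by rewrite lformC lformZl lformC. Qed.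

Lemma lformNl u w : lform (- u) w = - lform u w.
Proof. by rewrite -scaleN1r lformZl mulN1r. Qed.

Lemma lformNr u w : lform w (- u) = - lform w u.
Proof. by rewrite lformC lformNl lformC. Qed.

Definition lformE :=
  (lformDl, lformDr, lformZl, lformZr, lformNl, lformNr, hformxx).

(** Cauchy-Schwarz for the components of [y] and [v] orthogonal to [x], where
    the form is positive semidefinite. *)
Lemma hform_cs x y v :
  (lform y v + lform y x * lform v x) ^+ 2 <=
  (lform y x ^+ 2 - 1) * (lform v v + lform v x ^+ 2).
Proof.
have o w : lform (w + lform w x *: (x : 'rV_d.+1)) x = 0.
  by rewrite !lformE mulrN1 subrr.
have := ortho_cs (o y) (o v); rewrite !lformE (lformC x v) (lformC x y).
by congr (_ <= _); ring.
Qed.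

Lemma hform_le_m1 x y : lform x y <= -1.
Proof. by have := hform_le x y; lra. Qed.

(** The two sheets of the hyperboloid are told apart by the sign of the form
    against any point of the upper one. *)
Lemma hyperbolic_of_vector u x :
  lform u u = -1 -> lform u x < 0 -> {y : hyperbolic R d | y = u :> 'rV_d.+1}.
Proof.
move=> uu ux; suff u0 : 0 < u 0 ord0.
  have uP : (lform u u == -1) && (0 < u 0 ord0) by rewrite uu eqxx u0.
  by exists (Hyperbolic uP).
move: uu ux; have := hformxx x; have := hcoord_gt0 x; have := space_cs u x.
have := space_ge0 u; have := space_ge0 x; rewrite /lform.
move: (\sum_i _) (\sum_i _) (\sum_i _) => UX U X.
move: (u 0 ord0) (x 0 ord0) => a b X0 U0 cs b0 xx uu ux.
have e1 : X = b ^+ 2 - 1 by lra.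
have e2 : U = a ^+ 2 - 1 by lra.
rewrite e1 e2 in cs X0 U0; rewrite ltNge; apply/negP => a0.
have ab : a * b <= 0 by nra.
have h : (a * b) ^+ 2 < UX ^+ 2 by nra.
by nra.
Qed.

Lemma hform_eqm1 x y : lform x y = -1 -> x = y.
Proof.
by move=> xy; apply: hdist_positivity; rewrite /hdist xy opprK arcosh1.
Qed.

End LorentzForm.

(** * Hyperbolic functions *)

Section HyperbolicFunctions.
Variable R : realType.
Implicit Types r s t x y : R.

Definition ch r := (expR r + expR (- r)) / 2.
Definition sh r := (expR r - expR (- r)) / 2.

Lemma ch2sh2 r : ch r ^+ 2 - sh r ^+ 2 = 1.
Proof.
have : expR r * expR (- r) = 1 by rewrite expRN mulfV // gt_eqF ?expR_gt0.
by rewrite /ch /sh; move: (expR r) (expR _) => a b; nra.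
Qed.

Lemma chB s t : ch (s - t) = ch s * ch t - sh s * sh t.
Proof. by rewrite /ch /sh opprB !expRD; field. Qed.

Lemma chN r : ch (- r) = ch r.
Proof. by rewrite /ch opprK addrC. Qed.

Lemma ch_gt0 r : 0 < ch r.
Proof. by rewrite /ch divr_gt0 // addr_gt0 // expR_gt0. Qed.

Lemma sh_ge0 r : 0 <= r -> 0 <= sh r.
Proof.
by move=> r0; rewrite /sh divr_ge0 // subr_ge0 ler_expR; lra.
Qed.

Lemma ch_ge1 r : 1 <= ch r.
Proof. by have := ch2sh2 r; have := ch_gt0 r; nra. Qed.

Lemma arcosh_ch r : arcosh (ch r) = `|r|.
Proof.
wlog r0 : r / 0 <= r.
  move=> h; have [/h //|r0] := lerP 0 r.
  by rewrite -chN -normrN h //; lra.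
rewrite /arcosh.
have -> : ch r ^+ 2 - 1 = sh r ^+ 2 by have := ch2sh2 r; lra.
rewrite sqrtr_sqr !ger0_norm ?sh_ge0 //.
have -> : ch r + sh r = expR r by rewrite /ch /sh; field.
by rewrite expRK.
Qed.

(** This and the next lemma recover the parameter of a point of the hyperbola
    branch [x ^+ 2 - y ^+ 2 = 1], [0 < x]; [ln (x + y)] because
    [ch t + sh t = expR t]. *)
Lemma ch_ln x y : 0 < x -> x ^+ 2 - y ^+ 2 = 1 -> ch (ln (x + y)) = x.
Proof.
move=> x0 xy; have s0 : 0 < x + y by nra.
have i : (x + y)^-1 = x - y.
  by apply: (mulfI (lt0r_neq0 s0)); rewrite mulfV ?lt0r_neq0 //; rewrite -xy; ring.
by rewrite /ch expRN lnK // i; field.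
Qed.

Lemma sh_ln x y : 0 < x -> x ^+ 2 - y ^+ 2 = 1 -> sh (ln (x + y)) = y.
Proof.
move=> x0 xy; have s0 : 0 < x + y by nra.
have i : (x + y)^-1 = x - y.
  by apply: (mulfI (lt0r_neq0 s0)); rewrite mulfV ?lt0r_neq0 //; rewrite -xy; ring.
by rewrite /sh expRN lnK // i; field.
Qed.

Lemma arcosh_ge0 x : 1 <= x -> 0 <= arcosh x.
Proof. by move=> x1; rewrite -(arcosh1 R) arcosh_le. Qed.

Lemma ch_arcosh x : 1 <= x -> ch (arcosh x) = x.
Proof.
move=> x1; rewrite /arcosh ch_ln //; first by lra.
by rewrite sqr_sqrtr; nra.
Qed.

Lemma arcosh_inj x y : 1 <= x -> 1 <= y -> arcosh x = arcosh y -> x = y.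
Proof. by move=> x1 y1 e; rewrite -(ch_arcosh x1) -(ch_arcosh y1) e. Qed.

Lemma arcosh_lt x y : 1 <= x -> x < y -> arcosh x < arcosh y.
Proof.
move=> x1 xy; have y1 : 1 <= y by lra.
rewrite lt_neqAle arcosh_le ?andbT //; last by lra.
by apply/eqP => /(arcosh_inj x1 y1) e; lra.
Qed.

Lemma lt_arcosh x y : 1 <= y -> arcosh x < arcosh y -> x < y.
Proof.
by move=> y1; apply: contraTT; rewrite -!leNgt => yx; exact: arcosh_le.
Qed.

Lemma sqr_sqrt1D s : Num.sqrt (1 + s ^+ 2) ^+ 2 = 1 + s ^+ 2.
Proof. by rewrite sqr_sqrtr //; nra. Qed.

Lemma sqrt1D_ge1 s : 1 <= Num.sqrt (1 + s ^+ 2).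
Proof.
by have := sqr_sqrt1D s; have := sqrtr_ge0 (1 + s ^+ 2); nra.
Qed.

End HyperbolicFunctions.

(** * Geodesic convexity in linear terms *)

Section Convexity.
Variables (R : realType) (d : nat).
Local Notation hyp := (hyperbolic R d).
Implicit Types (a b c x y : hyp) (u v : 'rV[R]_d.+1).

Lemma mdistE x y : mdist x y = arcosh (- lform x y).
Proof. by []. Qed.

Lemma geodesic_point a u (r : R) : lform u a = 0 -> lform u u = 1 ->
  {y : hyp | y = ch r *: (a : 'rV_d.+1) + sh r *: u :> 'rV_d.+1}.
Proof.
move=> ua uu; have au : lform a u = 0 by rewrite lformC.
apply: (@hyperbolic_of_vector _ _ _ a); rewrite !lformE ua ?au ?uu.
  by have := ch2sh2 r; lra.
by rewrite mulr0 addr0 mulrN1 oppr_lt0 ch_gt0.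
Qed.

(** In the hyperboloid model the segment from [a] to [b] is the central
    projection of the straight one, so a convex set contains every point of
    the hyperboloid that is a nonnegative combination of two of its points. *)
Lemma convex_combination (C : set hyp) a b c (p q : R) :
  Defs.convex C -> C a -> C b -> 0 <= p -> 0 <= q ->
  c = p *: (a : 'rV_d.+1) + q *: (b : 'rV_d.+1) :> 'rV_d.+1 -> C c.
Proof.
move=> cC Ca Cb p0 q0 ce; have := hformxx c; rewrite ce !lformE => cc.
have [ab|ab] := eqVneq a b.
  subst b; suff -> : c = a by [].
  rewrite hformxx in cc; apply: val_inj => /=.
  have pq : p + q = 1.
    by apply/eqP; rewrite -(@eqrXn2 _ 2) ?ler01 ?addr_ge0 //; apply/eqP; lra.
  by rewrite ce -scalerDl pq scale1r.
have X1 : 1 < - lform a b.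
  rewrite lt_neqAle hform_le andbT; apply/eqP => e; case/eqP: ab.
  by apply: hform_eqm1; lra.
have Y0 := sqrtr_ge0 ((- lform a b) ^+ 2 - 1).
have : Num.sqrt ((- lform a b) ^+ 2 - 1) ^+ 2 = (- lform a b) ^+ 2 - 1.
  by rewrite sqr_sqrtr //; nra.
move eY : (Num.sqrt _) Y0 => Y Y0 YY; move eX : (- lform a b) X1 YY eY => X.
move=> X1 YY eY; have {eX}eX : lform a b = - X by lra.
have {}Y0 : 0 < Y by rewrite lt0r Y0 andbT; apply/eqP => e; rewrite e in YY; nra.
have YV : Y * Y^-1 = 1 by rewrite mulfV // gt_eqF.
pose u := Y^-1 *: ((b : 'rV_d.+1) - X *: (a : 'rV_d.+1)).
have ua : lform u a = 0 by rewrite /u !lformE (lformC b) eX; ring.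
have uu : lform u u = 1.
  rewrite /u !lformE (lformC b a) eX; transitivity ((Y * Y^-1) ^+ 2).
    by rewrite exprMn YY; ring.
  by rewrite YV expr1n.
have dab : mdist a b = arcosh X by rewrite mdistE eX opprK.
have eu : b = X *: (a : 'rV_d.+1) + Y *: u :> 'rV_d.+1.
  by rewrite /u scalerA YV scale1r addrC subrK.
clearbody u; pose g r : hyp := sval (geodesic_point r ua uu).
have gE r : g r = ch r *: (a : 'rV_d.+1) + sh r *: u :> 'rV_d.+1.
  exact: (svalP (geodesic_point r ua uu)).
have X21 : X ^+ 2 - Y ^+ 2 = 1 by rewrite YY; ring.
have dE : arcosh X = ln (X + Y) by rewrite /arcosh eY.
have chd : ch (arcosh X) = X by rewrite dE ch_ln //; lra.
have shd : sh (arcosh X) = Y by rewrite dE sh_ln //; lra.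
have gg : geodesic a b g.
  split=> [||s t _ _].
  - apply: val_inj => /=; rewrite gE /ch /sh oppr0 expR0 subrr mul0r.
    by rewrite scale0r addr0 -mulr2n divff ?scale1r // pnatr_eq0.
  - by apply: val_inj => /=; rewrite gE dab chd shd -eu.
  - rewrite mdistE !gE !lformE (lformC a u) ua uu.
    by rewrite -arcosh_ch chB; congr arcosh; ring.
apply: (cC a b Ca Cb); exists g; split => //.
(* coordinates of [c] in the basis [a], [u] *)
pose x := p + q * X; pose y := q * Y.
have xy : x ^+ 2 - y ^+ 2 = 1.
  rewrite /x /y exprMn YY; rewrite (lformC b a) eX in cc.
  by lra.
have y0 : 0 <= y by rewrite /y mulr_ge0 // ltW.
have x0' : 0 <= x by rewrite /x addr_ge0 // mulr_ge0 //; lra.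
have x0 : 0 < x by nra.
exists (ln (x + y)); last first.
  apply: val_inj => /=; rewrite gE ch_ln // sh_ln // ce eu /x /y.
  by rewrite scalerDl scalerDr !scalerA addrA.
rewrite ln_ge0 ?dab ?dE /=; last by nra.
have yX : y * X <= Y * x by rewrite /x /y; nra.
clearbody x y.
have xX : x <= X.
  have h : (y * X) ^+ 2 <= (Y * x) ^+ 2 by rewrite ler_sqr ?nnegrE; nra.
  have : x ^+ 2 <= X ^+ 2.
    have e1 : y ^+ 2 = x ^+ 2 - 1 by lra.
    have e2 : Y ^+ 2 = X ^+ 2 - 1 by lra.
    by rewrite !exprMn e1 e2 in h; lra.
  by rewrite ler_sqr ?nnegrE //; lra.
have yY : y <= Y by rewrite -ler_sqr ?nnegrE //; nra.
by rewrite ler_ln ?posrE; lra.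
Qed.

End Convexity.

(** * Topology of the hyperboloid *)

Section Topology.
Variables (R : realType) (d : nat).
Local Notation hyp := (hyperbolic R d).
Implicit Types (a b c x y : hyp) (u v : 'rV[R]_d.+1) (C : set hyp).

(** Neighbourhoods are read off the form: the distance from [x] is small when
    [- lform x y] is close to [1]. *)
Lemma hnbhsP x (A : set hyp) :
  nbhs x A <-> exists2 e : R, 0 < e & forall y, - lform x y < 1 + e -> A y.
Proof.
split=> [/nbhs_ballP[/= r r0 rA]|[e e0 eA]]; last first.
  have e1 : 1 < 1 + e by lra.
  apply/nbhs_ballP; exists (arcosh (1 + e)) => /=.
    by rewrite -(arcosh1 R) arcosh_lt.
  move=> y; rewrite ballEmdist /= mdistE => /lt_arcosh h.
  by apply/eA/h; lra.
exists (ch r - 1).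
  rewrite subr_gt0 ltNge; apply/negP => h.
  have := arcosh_ch r; have -> : ch r = 1 by have := ch_ge1 r; lra.
  by rewrite arcosh1 gtr0_norm //; lra.
move=> y h; apply: rA; rewrite ballEmdist /= mdistE.
rewrite -(gtr0_norm r0) -arcosh_ch; apply: arcosh_lt; first exact: hform_le.
by lra.
Qed.

(** [hform_cs] at [x] bounds [lform y v] in terms of [lform y x], which is
    close to [-1] when [y] is close to [x]. *)
Lemma lform_continuous v : continuous (fun x : hyp => lform x v).
Proof.
move=> x A /nbhs_ballP[/= e e0 eA]; apply/hnbhsP.
set B := lform v v + lform v x ^+ 2; set D := `|lform v x|.
have D0 : 0 <= D by exact: normr_ge0.
have B0 : 0 <= B.
  have := @ortho_ge0 _ _ x (v + lform v x *: (x : 'rV_d.+1)).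
  rewrite !lformE mulrN1 subrr (lformC x v) => /(_ erefl).
  by rewrite /B; nra.
(* [h] is chosen so that [t := lform y x] with [- t < 1 + h] satisfies both
   [(t ^+ 2 - 1) * B <= f ^+ 2] and [(- t - 1) * D < e / 2] *)
pose k := 1 + B + D; pose f := Num.min 1 (e / 2).
have f0 : 0 < f by rewrite /f lt_min ltr01; lra.
have fe : f <= e / 2 by rewrite /f ge_min lexx orbT.
have f1 : f <= 1 by rewrite /f ge_min lexx.
have k1 : 1 <= k by rewrite /k; lra.
pose h := f ^+ 2 / (3 * k); have h0 : 0 < h.
  by rewrite /h divr_gt0 ?exprn_gt0 // mulr_gt0; lra.
have hk : h * (3 * k) = f ^+ 2 by rewrite /h divfK // gt_eqF //; lra.
exists h => // y yx; apply: eA; rewrite -ball_normE /= distrC.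
have := hform_cs x y v; rewrite -/B; have := hform_le x y.
rewrite (lformC x y) in yx *; move: (lform y x) yx => t tlt t1.
have eD : lform v x ^+ 2 = D ^+ 2 by rewrite /D real_normK ?num_real.
rewrite (lformC x v).
move=> cs; have t2 : t ^+ 2 - 1 <= 3 * h.
  have hk3 : h * 3 <= h * (3 * k) by rewrite ler_pM2l //; lra.
  have ff : f ^+ 2 <= 1 by rewrite expr_le1 // ltW.
  have h1 : h <= 1 by lra.
  by nra.
have hB : (t ^+ 2 - 1) * B <= f ^+ 2.
  have := ler_wpM2r B0 t2.
  have : h * B <= h * k by rewrite ler_pM2l // /k; lra.
  lra.
have : `|lform y v + t * lform v x| <= f.
  by rewrite -ler_sqr ?nnegrE // ?real_normK ?num_real //; lra.
have : `|(- t - 1) * lform v x| < e / 2 .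
  have u0 : 0 <= - t - 1 by lra.
  have uh : - t - 1 <= h by lra.
  rewrite normrM -/D (ger0_norm u0); have := ler_wpM2r D0 uh.
  have : h * D <= h * k by rewrite ler_pM2l // /k; lra.
  have : f ^+ 2 <= f by rewrite expr2 ger_pMr.
  lra.
rewrite !ltr_norml ler_norml => /andP[? ?] /andP[? ?]; apply/andP; split; lra.
Qed.

End Topology.

(** * Compactness of closed bounded sets *)

Section Compactness.
Variables (R : realType) (d : nat).
Local Notation hyp := (hyperbolic R d).
Implicit Types (a b c x y : hyp) (u v w : 'rV[R]_d.+1) (C : set hyp).

Lemma coord_lform u (i : 'I_d.+1) :
  `|u 0 i| = `|lform u (delta_mx 0 i)|.
Proof.
rewrite /lform; case: (unliftP ord0 i) => [j|] ->.
  rewrite (bigD1 j) //= big1 => [|k kj].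
    by rewrite !mxE !eqxx /= !mulr1 mulr0 addr0 subr0.
  by rewrite !mxE /= (inj_eq lift_inj) (negbTE kj) mulr0.
by rewrite big1 => [|k _]; rewrite !mxE /= ?mulr0 // mulr1 sub0r normrN.
Qed.

(** Again by [hform_cs]: a ball around [a] is bounded in every coordinate. *)
Lemma lform_bounded a v (T : R) :
  exists M : R, 0 <= M /\ forall x, - lform x a <= T -> `|lform x v| <= M.
Proof.
have [T1|T1] := ltP T 1.
  by exists 0; split => // x xT; have := hform_le x a; lra.
set B := lform v v + lform v a ^+ 2; set D := `|lform v a|.
have D0 : 0 <= D by exact: normr_ge0.
have TD : 0 <= T * D by apply: mulr_ge0 => //; lra.
have := sqrtr_ge0 (T ^+ 2 * B); set S := Num.sqrt _ => S0.
exists (S + T * D); split=> [|x xT]; first exact: addr_ge0.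
have t1 := hform_le x a; have := hform_cs a x v; rewrite -/B => cs.
have B0 : 0 <= B.
  have := @ortho_ge0 _ _ a (v + lform v a *: (a : 'rV_d.+1)).
  rewrite !lformE mulrN1 subrr (lformC a v) => /(_ erefl).
  by rewrite /B; nra.
have h1 : `|lform x v + lform x a * lform v a| <= S.
  rewrite -ler_sqr ?nnegrE // real_normK ?num_real // sqr_sqrtr; last first.
    by rewrite mulr_ge0 // sqr_ge0.
  by apply: le_trans cs _; rewrite ler_wpM2r //; nra.
have h2 : `|lform x a * lform v a| <= T * D.
  rewrite normrM -/D ler_wpM2r // ler_norml; lra.
have -> : lform x v = lform x v + lform x a * lform v a - lform x a * lform v a.
  by ring.
by apply: (le_trans (ler_normB _ _)); exact: lerD.
Qed.

Lemma lform_row_continuous (f g : 'rV[R]_d.+1 -> 'rV[R]_d.+1) :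
  continuous f -> continuous g -> continuous (fun u => lform (f u) (g u)).
Proof.
move=> cf cg u; rewrite /lform.
have coord (h : 'rV[R]_d.+1 -> 'rV[R]_d.+1) i : continuous h ->
    (h v 0 i @[v --> u] --> h u 0 i).
  move=> hc; apply: (@continuous_comp _ _ _ h (fun v => v 0 i) u (hc u)).
  exact: coord_continuous.
have uF : Filter (nbhs u) by exact: nbhs_filter.
apply: (@cvgB _ _ _ (nbhs u)); last first.
  by apply: (@cvgM _ _ (nbhs u)); [exact: (coord f)|exact: (coord g)].
apply: (@cvg_big _ _ _ _ _ _ _ (nbhs u)) => [|i _]; first exact: add_continuous.
by apply: (@cvgM _ _ (nbhs u)); [exact: (coord f)|exact: (coord g)].
Qed.

Lemma lform_sqr_continuous : continuous (fun u : 'rV[R]_d.+1 => lform u u).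
Proof. by apply: (@lform_row_continuous id id) => u; exact: cvg_id. Qed.

Lemma lform_l_continuous v : continuous (fun u : 'rV[R]_d.+1 => lform u v).
Proof.
apply: (@lform_row_continuous id (fun=> v)); last exact: cst_continuous.
by move=> u; exact: cvg_id.
Qed.

(** The topology of coordinates is at least as fine as the metric one, which
    transfers limits of coordinates back to the hyperboloid. *)
Lemma hnbhs_row x (A : set hyp) : nbhs x A ->
  nbhs (x : 'rV[R]_d.+1) [set u | forall y, y = u :> 'rV_d.+1 -> A y].
Proof.
move=> /hnbhsP[e e0 eA].
have nx : nbhs (lform x x) [set t : R | - (1 + e) < t].
  by apply: lt_nbhsr; rewrite hformxx; lra.
have := @lform_l_continuous x x _ nx; apply: (@filterS _ (nbhs (x : 'rV_d.+1))).
move=> u /= ue y yu; apply: eA.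
by rewrite lformC yu; lra.
Qed.

(** The set of coordinates is closed, because the upper sheet is the closed set
    [lform u u = -1], [lform u a <= -1], and bounded, hence compact. *)
Lemma closed_bounded_compact C : closed C -> metric_bounded C -> compact C.
Proof.
move=> clC [M bM].
have [[a Ca]|/forallNP C0] := pselect (exists a, C a); last first.
  suff -> : C = set0 by exact: compact0.
  by rewrite -subset0 => x /C0.
pose K := [set (x : 'rV[R]_d.+1) | x in C].
have cK : compact K.
  apply: bounded_closed_compact.
    have bd (i : 'I_d.+1) : exists N : R,
        0 <= N /\ forall x, C x -> `|x 0 i| <= N.
      have [N [N0 NP]] := lform_bounded a (delta_mx 0 i) (ch M).
      exists N; split => // x Cx; rewrite coord_lform; apply: NP.
      have := bM _ _ Cx Ca; rewrite mdistE => h.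
      rewrite leNgt; apply/negP => /(arcosh_lt (ch_ge1 M)); rewrite arcosh_ch.
      by have := ler_norm M; lra.
    have [N NP] := choice bd.
    exists (\sum_i N i); split; first exact: num_real.
    move=> r /ltW Nr _ [x Cx <-]; apply: le_trans Nr.
    rewrite [leLHS]/Num.norm /= mx_normrE; apply/bigmax_leP; split=> [|[i j] _ /=].
      by apply: sumr_ge0 => i _; exact: (NP i).1.
    rewrite ord1; apply: (le_trans ((NP j).2 _ Cx)).
    rewrite (bigD1 j) //= lerDl; apply: sumr_ge0 => k _; exact: (NP k).1.
  have lim (f : 'rV[R]_d.+1 -> R) (D : set R) : continuous f -> closed D ->
      (forall x, C x -> D (f x)) -> closure K `<=` f @^-1` D.
    move=> cf clD CD; have : closed (f @^-1` D).
      by apply: preimage_closed clD => u _; exact: cf.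
    by move=> /closure_id ->; apply: closureS => _ [x /CD Dx <-].
  move=> v vK.
  have vv : lform v v = -1.
    apply: (lim (fun u => lform u u) _ _ (@closed_eq _ (-1)) _ v vK).
      exact: lform_sqr_continuous.
    by move=> x _ /=; exact: hformxx.
  have va : lform v a <= -1.
    apply: (lim (fun u => lform u a) _ _ (@closed_le _ (-1)) _ v vK).
      exact: lform_l_continuous.
    by move=> x _ /=; exact: hform_le_m1.
  have [|x xv] := hyperbolic_of_vector vv (x := a); first by lra.
  exists x => //; apply: clC => A /hnbhs_row; rewrite xv => /vK[_ [[y Cy <-]]].
  by move=> /(_ y erefl) Ay; exists y.
move=> F FF FC.
have FI (A : set hyp) : F A -> F (@hcoord R d @^-1` (@hcoord R d @` A)).
  by apply: filterS => x Ax; exists x.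
have [_ [[c Cc <-] cF]] := cK (hcoord x @[x --> F]) _ (FI _ FC).
exists c; split=> // A B FA /hnbhs_row cB.
have [_ [[x Ax <-]]] := cF _ _ (FI _ FA) cB.
by move=> /(_ x erefl) Bx; exists x.
Qed.

Lemma body_max C (f : hyp -> R) : closed C -> metric_bounded C -> C !=set0 ->
  continuous f -> exists2 c, C c & forall x, C x -> f x <= f c.
Proof.
move=> clC bC C0 cf; have cC := closed_bounded_compact clC bC.
have [c + cmax] := compact_EVT_max C0 cC (continuous_subspaceT cf).
by rewrite inE => Cc; exists c => // x Cx; apply: cmax; rewrite inE.
Qed.

End Compactness.

(** * Supporting hyperplanes and inner normals *)

Section Support.
Variables (R : realType) (d : nat).
Local Notation hyp := (hyperbolic R d).
Implicit Types (a b c x y z : hyp) (u v n : 'rV[R]_d.+1) (C : set hyp).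
Implicit Types (H J : hyperplane R d).

Lemma normalize v x : lform v v < 0 -> lform v x < 0 ->
  exists y : hyp, exists2 k : R, 0 < k & y = k *: v :> 'rV_d.+1.
Proof.
move=> vv vx; pose s := Num.sqrt (- lform v v).
have s0 : 0 < s by rewrite sqrtr_gt0; lra.
have ss : s ^+ 2 = - lform v v by rewrite sqr_sqrtr //; lra.
have k0 : 0 < s^-1 by rewrite invr_gt0.
have e1 : lform (s^-1 *: v) (s^-1 *: v) = -1.
  have -> : lform (s^-1 *: v) (s^-1 *: v) = - (s^-1 ^+ 2 * s ^+ 2).
    by rewrite !lformE ss; ring.
  by rewrite -exprMn mulVf ?expr1n // gt_eqF.
have [|y yE] := hyperbolic_of_vector e1 (x := x); first by rewrite lformZl pmulr_rlt0.
by exists y, s^-1.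
Qed.

(** If [y = p c + q x] with [c] interior and [p > 0], then every [y'] near [y]
    has the form [p' c' + q x] with [c'] near [c]: take [c'] proportional to
    [y' - q x]. *)
Lemma interior_combination C c x y (p q : R) :
  Defs.convex C -> C° c -> C x -> 0 < p -> 0 <= q ->
  y = p *: (c : 'rV_d.+1) + q *: (x : 'rV_d.+1) :> 'rV_d.+1 -> C° y.
Proof.
move=> cC /hnbhsP[e e0 eC] Cx p0 q0 yE.
have yy := hformxx y; rewrite yE !lformE (lformC x c) in yy.
pose P (z : hyp) : R := 1 + q ^+ 2 + 2 * q * lform z x.
pose G (z : hyp) : R := lform z c - q * lform x c.
have cP : continuous P.
  move=> z; apply: (@continuousD _ _ _ (cst (1 + q ^+ 2)) _ z).
    exact: cst_continuous.
  apply: (@continuousM _ _ (cst (2 * q)) _ z); first exact: cst_continuous.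
  exact: lform_continuous.
have cG : continuous G.
  move=> z; apply: (@continuousB _ _ _ _ (cst (q * lform x c)) z).
    exact: lform_continuous.
  exact: cst_continuous.
pose h (z : hyp) : R := (1 + e) ^+ 2 * P z - G z * G z.
have ctsh : continuous h.
  move=> z; apply: (@continuousB _ _ _ (fun z => (1 + e) ^+ 2 * P z) _ z).
    apply: (@continuousM _ _ (cst ((1 + e) ^+ 2)) _ z); last exact: cP.
    exact: cst_continuous.
  by apply: (@continuousM _ _ G G z); exact: cG.
have Py : P y = p ^+ 2 by rewrite /P yE !lformE; lra.
have Gy : G y = - p by rewrite /G yE !lformE; lra.
have hy : 0 < h y.
  have -> : h y = e * (2 + e) * p ^+ 2 by rewrite /h Py Gy; ring.
  by rewrite !mulr_gt0 ?exprn_gt0 //; lra.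
have nP : nbhs y [set z | 0 < P z].
  by apply: (cP y [set t | 0 < t]); apply: lt_nbhsr; rewrite Py exprn_gt0.
have nG : nbhs y [set z | G z < 0].
  by apply: (cG y [set t | t < 0]); apply: lt_nbhsl; rewrite Gy; lra.
have nh : nbhs y [set z | 0 < h z] by apply: (ctsh y [set t | 0 < t]); apply: lt_nbhsr.
suff : nbhs y C by [].
apply: (@filterS _ (nbhs y) _ _ C _ (filterI nP (filterI nG nh))).
move=> z [/= Pz [Gz hz]].
pose v := (z : 'rV_d.+1) - q *: (x : 'rV_d.+1).
have vv : lform v v = - P z by rewrite /v /P !lformE (lformC x z); ring.
have vc : lform v c = G z by rewrite /v /G !lformE.
have zE : z = v + q *: (x : 'rV_d.+1) :> 'rV_d.+1 by rewrite subrK.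
clearbody v; have [||c' [k k0 c'E]] := @normalize v c; rewrite ?vv ?vc //; first by lra.
have kk : k ^+ 2 * P z = 1.
  by have := hformxx c'; rewrite c'E !lformE vv; lra.
have Cc' : C c'.
  apply: eC; rewrite lformC c'E lformE vc.
  have : (k * G z) ^+ 2 < (1 + e) ^+ 2.
    have k2 : 0 < k ^+ 2 by rewrite exprn_gt0.
    have := mulr_gt0 k2 hz; rewrite /h; nra.
  by nra.
apply: (convex_combination cC Cc' Cx (p := k^-1) (q := q)) => //.
  by rewrite invr_ge0 ltW.
by rewrite zE c'E scalerA mulVf ?gt_eqF // scale1r.
Qed.

(** From an interior point at height 0 a short move against [n] would stay in
    [C] and have negative height. *)
Lemma interior_gt0 C c n : lform n n = 1 ->
  (forall x, C x -> 0 <= lform x n) -> C° c -> 0 < lform c n.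
Proof.
move=> nn Cn cC; have := Cn _ (interior_subset cC); rewrite le_eqVlt.
case/orP=> // /eqP/esym cn; have nc : lform n c = 0 by rewrite lformC.
move: cC => /hnbhsP[e e0 eC].
have te : Num.sqrt e ^+ 2 = e by rewrite sqr_sqrtr // ltW.
have t0 : 0 < Num.sqrt e by rewrite sqrtr_gt0.
move: (Num.sqrt e) te t0 => t te t0.
have := sqr_sqrt1D t; have := sqrt1D_ge1 t.
move: (Num.sqrt _) => w w1 ww.
pose v := w *: (c : 'rV_d.+1) - t *: n.
have [||c' c'E] := @hyperbolic_of_vector _ _ v c.
- by rewrite /v !lformE cn nc nn; lra.
- by rewrite /v !lformE nc; lra.
have := Cn c'; rewrite c'E /v !lformE cn nn => h.
suff /h : C c' by lra.
by apply: eC; rewrite lformC c'E /v !lformE nc; nra.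
Qed.

(** [n] replaces the normal of [H] by a unit multiple pointing to the side of
    [C]. The kernels are compared on all vectors, since both the points and the
    ideal points of [H] matter for ultraparallelism. *)
Definition inner_normal H C n :=
  [/\ lform n n = 1, forall u, lform u (normal H) = 0 <-> lform u n = 0 &
    forall x, C x -> 0 <= lform x n].

(** If [C] had points on both sides of [H], a segment from an interior point to
    a point of the other side would meet [H] in an interior point. *)
Lemma supports_inner_normal H C :
  convex_body C -> supports H C -> exists n, inner_normal H C n.
Proof.
move=> [_ _ cC [c cC0]] [_ HC].
have L0 := normal_gt0 H; pose s := Num.sqrt (lform (normal H) (normal H)).
have s0 : 0 < s by rewrite sqrtr_gt0.
have ss : s ^+ 2 = lform (normal H) (normal H) by rewrite sqr_sqrtr // ltW.
have off y : C° y -> lform y (normal H) != 0.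
  by move=> yC; apply/eqP => yH; have : set0 y by rewrite -HC.
have [k k0 [kk kc]] : exists2 k : R, k != 0 &
    k ^+ 2 * s ^+ 2 = 1 /\ 0 < k * lform c (normal H).
  have v0 : s^-1 != 0 by rewrite invr_eq0 gt_eqF.
  have vv : s^-1 ^+ 2 * s ^+ 2 = 1.
    by rewrite -exprMn mulVf ?expr1n // gt_eqF.
  have vp : 0 < s^-1 by rewrite invr_gt0.
  case: (ltgtP (lform c (normal H)) 0) => [lt|gt|e].
  - by exists (- s^-1); rewrite ?oppr_eq0 // sqrrN; split => //; nra.
  - by exists s^-1 => //; split => //; nra.
  - by have := off _ cC0; rewrite e eqxx.
exists (k *: normal H); split => [|u|x Cx].
- by rewrite !lformE -ss mulrA -expr2.
- rewrite lformE; split=> [->|/eqP]; first by rewrite mulr0.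
  by rewrite mulf_eq0 (negbTE k0) => /eqP.
rewrite leNgt; apply/negP => xn.
rewrite -lformZr in kc; move: (k *: _) kc xn (lformZr k (normal H)) => n.
move=> cn xn nE.
(* the segment from [c] to [x] meets [H] in the direction [a c + b x] *)
pose a := - lform x n; pose b := lform c n.
have [a0 b0] : 0 < a /\ 0 < b by rewrite /a /b; split; lra.
have [aE bE] : a = - lform x n /\ b = lform c n by [].
clearbody a b; have ab : 0 < a * b by exact: mulr_gt0.
have xc := hform_le_m1 x c.
have [||y [r r0 yE]] :=
    @normalize (a *: (c : 'rV_d.+1) + b *: (x : 'rV_d.+1)) c.
- rewrite !lformE (lformC c x); have := ler_pM2l ab (lform x c) (-1).
  by rewrite xc; nra.
- by rewrite !lformE; nra.
have yC : C° y.
  apply: (interior_combination cC cC0 Cx (p := r * a) (q := r * b)).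
  - exact: mulr_gt0.
  - by rewrite ltW // mulr_gt0.
  - by rewrite yE scalerDr !scalerA.
have /eqP := off _ yC; apply; apply: (mulfI k0); rewrite mulr0 -nE yE.
by rewrite !lformE aE bE; ring.
Qed.

Lemma inner_normal_supports H C n e :
  inner_normal H C n -> C e -> lform e n = 0 -> supports H C.
Proof.
move=> [nn nH Cn] Ce en; split; first by exists e; split => //; apply/nH.
rewrite -subset0 => x [/nH xn /(interior_gt0 nn Cn)].
by rewrite xn ltxx.
Qed.

End Support.

(** * The width determined by a supporting hyperplane *)

Section Width.
Variables (R : realType) (d : nat).
Local Notation hyp := (hyperbolic R d).
Implicit Types (a b c x y z p q : hyp) (u v m n : 'rV[R]_d.+1) (C : set hyp).
Implicit Types (H J : hyperplane R d) (s t : R).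

(** The inverse hyperbolic sine of [s >= 0]: the distance from a hyperplane with
    unit normal [n] to a point [x] with [lform x n = s]. *)
Definition height_dist s := arcosh (Num.sqrt (1 + s ^+ 2)).

Lemma height_dist_ge0 s : 0 <= height_dist s.
Proof. exact/arcosh_ge0/sqrt1D_ge1. Qed.

Lemma height_dist_lt s t : 0 <= s -> s < t -> height_dist s < height_dist t.
Proof.
by move=> s0 st; apply: arcosh_lt (sqrt1D_ge1 s) _; rewrite ltr_sqrt; nra.
Qed.

Lemma height_dist_le s t : 0 <= s -> s <= t -> height_dist s <= height_dist t.
Proof.
by move=> s0; rewrite le_eqVlt => /orP[/eqP->//|/(height_dist_lt s0)/ltW].
Qed.

Lemma height_dist_inj s t :
  0 <= s -> 0 <= t -> height_dist s = height_dist t -> s = t.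
Proof.
move=> s0 t0 e; case: (ltgtP s t) => // /height_dist_lt; rewrite e ltxx.
- by move/(_ s0).
- by move/(_ t0).
Qed.

Lemma foot_point n x : lform n n = 1 ->
  exists q : hyp, lform q n = 0 /\ mdist q x = height_dist (lform x n).
Proof.
move=> nn; set s := lform x n; pose v := (x : 'rV_d.+1) - s *: n.
have nx : lform n x = s by rewrite lformC.
have vv : lform v v = - (1 + s ^+ 2) by rewrite /v !lformE nx nn -/s; ring.
have vx : lform v x = - (1 + s ^+ 2) by rewrite /v !lformE nx; ring.
have vn : lform v n = 0 by rewrite /v !lformE nn -/s; ring.
clearbody v.
have [||q [k k0 qE]] := @normalize _ _ v x; rewrite ?vv ?vx; try nra.
exists q; rewrite mdistE qE !lformE vn vx mulr0 /height_dist; split => //.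
congr arcosh; have := hformxx q; rewrite qE !lformE vv => kk.
rewrite -[LHS]gtr0_norm; last by nra.
by rewrite -sqrtr_sqr; congr Num.sqrt; have := sqr_ge0 k; nra.
Qed.

Lemma height_dist_le_mdist n a b : lform n n = 1 -> lform a n = 0 ->
  height_dist (lform b n) <= mdist a b.
Proof.
move=> nn an; rewrite mdistE; apply: arcosh_le (sqrt1D_ge1 _) _.
have := hform_cs a b n; rewrite (lformC n a) an nn (lformC b a) => cs.
have ab0 : 0 <= - lform a b by have := hform_le a b; lra.
rewrite -ler_sqr ?nnegrE ?sqrtr_ge0 // sqr_sqrt1D; lra.
Qed.

Lemma setdist_le (A B : set hyp) a b : A a -> B b -> setdist A B <= mdist a b.
Proof.
move=> Aa Bb; apply: ge_inf; last by exists a => //; exists b.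
by exists 0 => _ [a' _ [b' _ <-]]; exact: mdist_ge0.
Qed.

Lemma setdist_ge (A B : set hyp) a b t : A a -> B b ->
  (forall a b, A a -> B b -> t <= mdist a b) -> t <= setdist A B.
Proof.
move=> Aa Bb h; apply: lb_le_inf; first by exists (mdist a b), a => //; exists b.
by move=> _ [a' Aa' [b' Bb' <-]]; exact: h.
Qed.

Lemma hyperplane_of_unit m C : lform m m = 1 ->
  (forall x, C x -> 0 <= lform x m) -> exists J, inner_normal J C m.
Proof.
move=> mm Cm; have m0 : 0 < lform m m by rewrite mm.
by exists (Hyperplane m0).
Qed.

(** Let [K] be the hyperplane normal to [n] and [p] a point at positive height
    over [K]. This is the unit normal, pointing towards [K], of the hyperplane
    through [p] perpendicular to the shortest segment from [p] to [K]. *)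
Definition opposite_normal n p : 'rV[R]_d.+1 :=
  - (Num.sqrt (1 + lform p n ^+ 2))^-1 *:
    (n + lform p n *: (p : 'rV_d.+1)).

Lemma lform_opposite_normal n p x :
  lform x (opposite_normal n p) =
  - (lform x n + lform p n * lform x p) / Num.sqrt (1 + lform p n ^+ 2).
Proof. by rewrite !lformE; ring. Qed.

Lemma opposite_normal_foot n p : lform p (opposite_normal n p) = 0.
Proof. by rewrite lform_opposite_normal hformxx mulrN1 subrr oppr0 mul0r. Qed.

Lemma opposite_normal_unit n p : lform n n = 1 ->
  lform (opposite_normal n p) (opposite_normal n p) = 1.
Proof.
move=> nn; rewrite !lformE (lformC n p) nn.
have := sqr_sqrt1D (lform p n); have := sqrt1D_ge1 (lform p n).
move: (Num.sqrt _) => w w1 ww.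
transitivity (w^-1 ^+ 2 * w ^+ 2); first by rewrite ww; ring.
by rewrite -exprMn mulVf ?expr1n // gt_eqF //; lra.
Qed.

(** Since [lform x p <= -1],
    [lform x n + lform p n * lform x p <= lform p n - lform p n]. *)
Lemma opposite_normal_ge0 C n p :
  (forall x, C x -> lform x n <= lform p n) -> 0 <= lform p n ->
  forall x, C x -> 0 <= lform x (opposite_normal n p).
Proof.
move=> Cn p0 x Cx; rewrite lform_opposite_normal.
rewrite divr_ge0 ?sqrtr_ge0 //; have := Cn x Cx; have := hform_le_m1 x p.
nra.
Qed.

(** The hyperplane [J] opposite to [H] at a highest point [p] is ultraparallel to
    [H]: a common vector, finite or ideal, would be orthogonal to both [n] and
    [p]. Its distance from [H] is that of [p], and any supporting hyperplane
    contains a point of [C], which is at most as far from [H] as [p]. *)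
Lemma width_height H C n p : convex_body C -> supports H C ->
  inner_normal H C n -> C p -> (forall x, C x -> lform x n <= lform p n) ->
  width H C = height_dist (lform p n).
Proof.
move=> cbC sH iH Cp pmax; have [nn nH Cn] := iH.
have s0 : 0 < lform p n.
  have [_ _ _ [c cC]] := cbC; apply: lt_le_trans (interior_gt0 nn Cn cC) _.
  exact/pmax/(interior_subset cC).
set m := opposite_normal n p.
have mm : lform m m = 1 by exact: opposite_normal_unit.
have [|J iJ] := hyperplane_of_unit mm (C := C).
  by apply: opposite_normal_ge0 pmax _; exact: ltW.
have pm : lform p m = 0 by exact: opposite_normal_foot.
have sJ : supports J C by exact: inner_normal_supports iJ Cp pm.
have [_ mJ _] := iJ.
have pJ : points J p by apply/mJ.
have w0 : Num.sqrt (1 + lform p n ^+ 2) != 0.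
  by rewrite gt_eqF // (lt_le_trans ltr01) // sqrt1D_ge1.
have Jn u : lform u (normal J) = 0 -> lform u n = - (lform p n * lform u p).
  move=> /mJ; rewrite /m /opposite_normal !lformE => /eqP.
  by rewrite mulf_eq0 oppr_eq0 invr_eq0 (negbTE w0) addr_eq0 => /eqP.
have HJ : ultraparallel H J.
  split; rewrite -subset0.
    move=> x [/nH xn /Jn]; rewrite xn => /esym/eqP; rewrite oppr_eq0 mulf_eq0.
    by rewrite gt_eqF //= => /eqP xp; have := hform_le_m1 x p; lra.
  move=> u [[u0 uu /nH un] [_ _ /Jn]]; rewrite un => /esym/eqP.
  rewrite oppr_eq0 mulf_eq0 gt_eqF //= => /eqP up.
  by move: u0; rewrite (ortho_eq0 up uu) eqxx.
have [q [qn qp]] := foot_point p nn; have qH : points H q by apply/nH.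
have dHJ : setdist (points H) (points J) = height_dist (lform p n).
  apply/le_anti/andP; split; first by rewrite -qp setdist_le.
  apply: (setdist_ge qH pJ) => a b /nH an /Jn bn.
  apply: le_trans (height_dist_le_mdist b nn an).
  by rewrite bn; apply: height_dist_le; have := hform_le_m1 b p; nra.
have maxJ J' : supports J' C ->
    setdist (points H) (points J') <= height_dist (lform p n).
  move=> [[x [xJ' Cx]] _]; have [q' [qn' qx']] := foot_point x nn.
  have qH' : points H q' by apply/nH.
  apply: (le_trans (setdist_le qH' xJ')); rewrite qx'.
  by apply: height_dist_le; [exact: Cn|exact: pmax].
have fJ : farthest H C J by split=> // J' _ sJ'; rewrite dHJ maxJ.
have [|J' [_ sJ' fJ'] wE] := @xgetPex _ 0
    [set setdist (points H) (points J) | J in farthest H C].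
  by exists (setdist (points H) (points J)), J.
rewrite /width -wE; apply/le_anti; rewrite maxJ //= -dHJ.
exact: fJ'.
Qed.

Lemma height_attained C n : convex_body C -> exists2 p, C p &
  forall x, C x -> lform x n <= lform p n.
Proof.
move=> [clC bC _ [c cC]]; apply: (body_max clC bC).
  by exists c; exact: interior_subset cC.
exact: lform_continuous.
Qed.

Lemma width_ge0 H C : convex_body C -> supports H C -> 0 <= width H C.
Proof.
move=> cbC sH; have [n iH] := supports_inner_normal cbC sH.
have [p Cp pmax] := height_attained n cbC.
by rewrite (width_height cbC sH iH Cp pmax) height_dist_ge0.
Qed.

Lemma thickness_le H C : convex_body C -> supports H C ->
  thickness C <= width H C.
Proof.
move=> cbC sH; apply: ge_inf; last by exists H.
by exists 0 => _ [J sJ <-]; exact: width_ge0.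
Qed.

End Width.

(** * Bodies of constant width *)

Section ConstantWidth.
Variables (R : realType) (d : nat).
Local Notation hyp := (hyperbolic R d).
Implicit Types (a b c e x y z p q : hyp) (u v m n : 'rV[R]_d.+1) (C W : set hyp).
Implicit Types (H J : hyperplane R d) (s t delta : R).

(** The height of [q] over the opposite hyperplane at [p] cannot exceed the
    height [s] of [p] over [H], because the two widths agree. This reads
    [- lform q p <= Num.sqrt (1 + s ^+ 2)]: the distance from [q] to [p] is at
    most that from [H] to [p], which leaves only the foot of the perpendicular
    for [q]. *)
Lemma constant_width_chord W delta H n p q : convex_body W ->
  (forall H', supports H' W -> width H' W = delta) ->
  inner_normal H W n -> W q -> lform q n = 0 ->
  W p -> (forall x, W x -> lform x n <= lform p n) ->
  p = Num.sqrt (1 + lform p n ^+ 2) *: (q : 'rV_d.+1) + lform p n *: n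
    :> 'rV_d.+1.
Proof.
move=> cbW wW iH Wq qn Wp pmax; have [nn _ Wn] := iH.
have sH := inner_normal_supports iH Wq qn.
have s0 : 0 < lform p n.
  have [_ _ _ [c cC]] := cbW; apply: lt_le_trans (interior_gt0 nn Wn cC) _.
  exact/pmax/(interior_subset cC).
set m := opposite_normal n p.
have mm : lform m m = 1 by exact: opposite_normal_unit.
have [|J iJ] := hyperplane_of_unit mm (C := W).
  by apply: opposite_normal_ge0 pmax _; exact: ltW.
have sJ := inner_normal_supports iJ Wp (opposite_normal_foot n p).
have [p' Wp' p'max] := height_attained m cbW.
have p'E : lform p' m = lform p n.
  apply: height_dist_inj; [by case: iJ => _ _; exact|exact: ltW|].
  by rewrite -(width_height cbW sJ iJ Wp' p'max) -(width_height cbW sH iH Wp pmax)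
    !wW.
have := p'max q Wq; rewrite p'E lform_opposite_normal qn add0r.
have := sqr_sqrt1D (lform p n); have := sqrt1D_ge1 (lform p n).
have nq : lform n q = 0 by rewrite lformC.
move: (Num.sqrt _) => w w1 ww; rewrite ler_pdivrMr; last by lra.
move=> qp; have {}qp : - lform q p <= w by nra.
(* [v] is the point at height [lform p n] above [q]; its form with [p] is at
   least [-1], so the two points agree *)
pose v := w *: (q : 'rV_d.+1) + lform p n *: n.
have vq : lform v q = - w by rewrite /v !lformE nq; ring.
have vv : lform v v = -1 by rewrite /v !lformE nq qn nn; lra.
have vp : lform v p = w * lform q p + lform p n ^+ 2.
  by rewrite /v !lformE (lformC n p); ring.
have [|y yE] := hyperbolic_of_vector vv (x := q); first by rewrite vq; lra.
rewrite -/v -yE; congr hcoord; apply/esym/hform_eqm1.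
apply/le_anti; rewrite hform_le_m1 /= yE vp; nra.
Qed.

(** A point [x] of maximal height over the opposite hyperplane at [p] is the end
    of a chord starting at [p] by [constant_width_chord], and this chord is the
    one from [q] to [p] reversed. *)
Lemma constant_width_opposite W delta H n q : convex_body W ->
  (forall H', supports H' W -> width H' W = delta) ->
  inner_normal H W n -> W q -> lform q n = 0 ->
  exists p m s, [/\ W p, lform m m = 1 /\ lform p m = 0,
    0 <= s /\ delta = height_dist s &
    forall x, W x -> 0 <= lform x m /\ (x <> q -> lform x m < s)].
Proof.
move=> cbW wW iH Wq qn; have [nn _ Wn] := iH.
have sH := inner_normal_supports iH Wq qn.
have [p Wp pmax] := height_attained n cbW.
have pE := constant_width_chord cbW wW iH Wq qn Wp pmax.
have dE : delta = height_dist (lform p n).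
  by rewrite -(wW _ sH) (width_height cbW sH iH Wp pmax).
have s0 : 0 <= lform p n by exact: Wn.
set m := opposite_normal n p.
have mm : lform m m = 1 by exact: opposite_normal_unit.
have pm : lform p m = 0 by exact: opposite_normal_foot.
have Wm := opposite_normal_ge0 pmax s0.
have [J iJ] := hyperplane_of_unit mm Wm.
have sJ := inner_normal_supports iJ Wp pm.
have [p' Wp' p'max] := height_attained m cbW.
have p'E : lform p' m = lform p n.
  apply: height_dist_inj => //; first exact: Wm.
  by rewrite -(width_height cbW sJ iJ Wp' p'max) -dE wW.
exists p, m, (lform p n); split=> // x Wx; split; first exact: Wm.
move=> xq; rewrite lt_neqAle -{2}p'E p'max // andbT; apply/eqP => xm.
apply: xq; apply: val_inj => /=.
have xmax y : W y -> lform y m <= lform x m by rewrite xm -p'E; exact: p'max.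
rewrite (constant_width_chord cbW wW iJ Wp pm Wx xmax) xm /m /opposite_normal.
have := sqr_sqrt1D (lform p n); have := sqrt1D_ge1 (lform p n).
move: (Num.sqrt _) pE => w pE w1 ww; have w0 : w != 0 by rewrite gt_eqF //; lra.
move: (lform p n) pE ww => s pE ww; apply: (scalerI w0).
have -> : w *: (q : 'rV_d.+1) = (p : 'rV_d.+1) - s *: n by rewrite pE addrK.
rewrite scalerDr !scalerA -expr2 ww.
have -> : w * s * - w^-1 = - s by field.
by apply/rowP => i; rewrite !mxE; ring.
Qed.

(** The vectors [v + t y] with [t ^+ 2 < 1] are the normals of the hyperplanes
    perpendicular to the geodesic through [y] with direction [v]. The one that
    touches [C] from the side of [v] is found by maximising the ratio of
    [lform x v] to [- lform x y]. *)
Lemma pencil_support C y v : closed C -> metric_bounded C -> C !=set0 ->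
  lform v v = 1 -> lform v y = 0 ->
  exists e t, [/\ C e, t ^+ 2 < 1, lform e (v + t *: (y : 'rV_d.+1)) = 0 &
    forall x, C x -> lform x (v + t *: (y : 'rV_d.+1)) <= 0].
Proof.
move=> clC bC C0 vv vy.
pose r (x : hyp) := lform x v / - lform x y.
have [|e Ce emax] := body_max clC bC C0 (f := r).
  move=> x; apply: (@continuousM _ _ (fun x : hyp => lform x v) _ x).
    exact: lform_continuous.
  apply: (@continuousV _ _ (fun x : hyp => - lform x y) x).
    by have := hform_le_m1 x y; rewrite oppr_eq0; lra.
  apply: (@continuousN _ _ _ (fun x : hyp => lform x y) x).
  exact: lform_continuous.
exists e, (r e); split => //.
- have := hform_cs y e v; rewrite vy vv; have := hform_le_m1 e y.
  rewrite /r; move: (lform e y) (lform e v) => k h k1 cs.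
  by rewrite expr_div_n sqrrN ltr_pdivrMr; nra.
- rewrite !lformE /r; have := hform_le_m1 e y => k1.
  by rewrite invrN mulrN mulNr divfK ?subrr // lt_eqF //; lra.
- move=> x Cx; have := emax x Cx; rewrite {1}/r !lformE.
  have := hform_le_m1 x y => k1.
  by rewrite ler_pdivrMr; lra.
Qed.

(** The hyperplane is taken at the point [y] of [C] nearest to [z],
    perpendicular to the segment from [y] to [z]. *)
Lemma separation C z : convex_body C -> ~ C z -> exists y v,
  [/\ lform v v = 1, lform v y = 0, 0 < lform z v &
    forall x, C x -> lform x v <= 0].
Proof.
move=> [clC bC cC [c cC0]] Cz.
have [||y Cy ymax] := body_max clC bC (f := fun x : hyp => lform x z).
- by exists c; exact: interior_subset cC0.
- exact: lform_continuous.
pose A := - lform y z.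
have A1 : 1 < A.
  rewrite lt_neqAle hform_le andbT; apply/eqP => e; apply: Cz.
  by rewrite -(@hform_eqm1 _ _ y z) //; rewrite /A in e; lra.
pose v0 := (z : 'rV[R]_d.+1) - A *: (y : 'rV[R]_d.+1).
pose s := Num.sqrt (A ^+ 2 - 1).
have ss : s ^+ 2 = A ^+ 2 - 1 by rewrite sqr_sqrtr //; nra.
have s0 : 0 < s by rewrite sqrtr_gt0; nra.
have sV : 0 < s^-1 by rewrite invr_gt0.
have zy : lform z y = - A by rewrite lformC opprK.
have yz : lform y z = - A by rewrite opprK.
exists y, (s^-1 *: v0); split.
- transitivity (s^-1 ^+ 2 * s ^+ 2); last first.
    by rewrite -exprMn mulVf ?expr1n // gt_eqF.
  by rewrite ss /v0 !lformE zy yz; ring.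
- by rewrite /v0 !lformE zy; ring.
- by rewrite /v0 !lformE zy mulr_gt0 //; nra.
move=> x Cx; rewrite lformZr pmulr_rle0 // /v0 !lformE.
pose B := - lform x z; pose k := - lform x y.
have B1 : 1 <= B by exact: hform_le.
have k1 : 1 <= k by exact: hform_le.
have AB : A <= B by rewrite /A /B lerN2; exact: ymax.
(* the points of the segment from [y] to [x], of direction [y + t x], are not
   nearer to [z] than [y] is *)
have opt t : 0 < t -> A ^+ 2 * (1 + 2 * t * k + t ^+ 2) <= (A + t * B) ^+ 2.
  move=> t0.
  have [||y' [r r0 y'E]] :=
      @normalize _ _ ((y : 'rV_d.+1) + t *: (x : 'rV_d.+1)) z.
  - by rewrite !lformE (lformC y x); rewrite /k in k1; nra.
  - by rewrite !lformE; rewrite /A in A1; rewrite /B in B1; nra.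
  have Cy' : C y'.
    apply: (convex_combination cC Cy Cx (p := r) (q := r * t)).
    - exact: ltW.
    - by rewrite mulr_ge0 // ltW.
    - by rewrite y'E scalerDr scalerA.
  have := ymax y' Cy'; rewrite y'E !lformE yz.
  have := hformxx y'; rewrite y'E !lformE (lformC y x).
  rewrite -[lform x z]opprK -/B -[lform x y]opprK -/k => rr ry.
  have N : r ^+ 2 * (1 + 2 * t * k + t ^+ 2) = 1 by lra.
  have h : A <= r * (A + t * B) by lra.
  have : A ^+ 2 <= (r * (A + t * B)) ^+ 2 by rewrite ler_sqr ?nnegrE; nra.
  rewrite exprMn => h2; have r2 : 0 < r ^+ 2 by rewrite exprn_gt0.
  by rewrite -(ler_pM2l r2); nra.
suff : A * k <= B by rewrite /B /k; lra.
rewrite leNgt; apply/negP => lt.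
(* if [B < A k] this fails for small [t], for instance for the [t] below *)
have D0 : 0 < A * k - B by lra.
pose t := A * (A * k - B) / B ^+ 2.
have t0 : 0 < t by rewrite divr_gt0 ?mulr_gt0 ?exprn_gt0 //; lra.
have tB : t * B ^+ 2 = A * (A * k - B).
  by rewrite divfK // gt_eqF // exprn_gt0 //; lra.
have := opt _ t0.
have e : (A + t * B) ^+ 2 - A ^+ 2 * (1 + 2 * t * k + t ^+ 2) =
  t * (t * B ^+ 2 - 2 * (A * (A * k - B)) - t * A ^+ 2) by ring.
rewrite -subr_ge0 e tB pmulr_rge0 //; have := mulr_gt0 t0 (exprn_gt0 2 (lt_trans ltr01 A1)).
nra.
Qed.

Lemma pencil_inner_normal C y v :
  convex_body C -> lform v v = 1 -> lform v y = 0 ->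
  exists H e k t, [/\ C e, inner_normal H C (- k *: (v + t *: (y : 'rV_d.+1))),
    supports H C, 0 < k /\ k ^+ 2 * (1 - t ^+ 2) = 1 &
    lform e v = - t * lform e y].
Proof.
move=> cbC vv vy; have [clC bC _ [c cC]] := cbC.
have [|e [t [Ce t1 et Ct]]] := pencil_support clC bC _ vv vy.
  by exists c; exact: interior_subset cC.
set u := v + t *: (y : 'rV[R]_d.+1) in et Ct *.
have uu : lform u u = 1 - t ^+ 2 by rewrite /u !lformE (lformC y v) vv vy; ring.
have ue : lform e v = - t * lform e y.
  by move: et; rewrite /u !lformE => /eqP; rewrite addr_eq0 mulNr => /eqP.
pose s := Num.sqrt (1 - t ^+ 2).
have ss : s ^+ 2 = 1 - t ^+ 2 by rewrite sqr_sqrtr //; lra.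
have s0 : 0 < s by rewrite sqrtr_gt0; lra.
have kk : s^-1 ^+ 2 * (1 - t ^+ 2) = 1.
  by rewrite -ss -exprMn mulVf ?expr1n // gt_eqF.
have k0 : 0 < s^-1 by rewrite invr_gt0.
have [||H iH] := @hyperplane_of_unit _ _ (- s^-1 *: u) C.
- by rewrite lformZl lformZr uu -[RHS]kk; ring.
- by move=> x Cx; have := Ct x Cx; rewrite lformZr; nra.
exists H, e, s^-1, t; split => //.
by apply: (inner_normal_supports iH Ce); rewrite lformZr et mulr0.
Qed.

End ConstantWidth.

Theorem proposition4 (R : realType) (d : nat) (W : set (hyperbolic R d)) :
  constant_width W -> reduced W.
Proof.
move=> [cbW [delta wW]]; split => // Z cbZ ZW ZneW.
have [z Wz Zz] : exists2 z, W z & ~ Z z.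
  apply: contrapT => h; apply: ZneW; apply/seteqP; split => // x Wx.
  by apply: contrapT => Zx; apply: h; exists x.
have [y [v [vv vy zv Zv]]] := separation cbZ Zz.
have [H [e [k [t [We iH sH [k0 _] ev]]]]] := pencil_inner_normal cbW vv vy.
(* [z] is in [W] and above the separating hyperplane, so [0 < t], and [e] is
   above it as well *)
have Ze : ~ Z e.
  move=> /Zv; have [_ _ /(_ _ Wz)] := iH; rewrite ev lformZr !lformE.
  have := hform_le_m1 z y; have := hform_le_m1 e y.
  move=> e1 z1; rewrite nmulr_rge0; last by lra.
  move=> h; have t0 : 0 < t by nra.
  nra.
have en : lform e (- k *: (v + t *: (y : 'rV_d.+1))) = 0.
  by rewrite !lformE ev; ring.
have [p [m [s [Wp [mm pm] [s0 dE] Wm]]]] :=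
  constant_width_opposite cbW wW iH We en.
have Zm x : Z x -> 0 <= lform x m < s.
  move=> Zx; have [-> /= h] := Wm x (ZW _ Zx); apply: h => xe.
  by rewrite -xe in Ze.
(* the pencil is turned round: it touches [Z] from the side of [- m] *)
have [||J [f [k' [t' [Zf iJ sJ [k'0 kk'] fm]]]]] :=
  @pencil_inner_normal _ _ Z p (- m) cbZ.
- by rewrite !lformE opprK.
- by rewrite lformNl lformC pm oppr0.
have t'0 : t' <= 0.
  have /andP[f0 _] := Zm f Zf; have := hform_le_m1 f p.
  by move: fm; rewrite lformNr; nra.
have [g Zg gmax] := height_attained (- k' *: (- m + t' *: (p : 'rV_d.+1))) cbZ.
have g0 : 0 <= lform g (- k' *: (- m + t' *: (p : 'rV_d.+1))).
  by have [_ _] := iJ; exact.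
have tW : thickness W = delta.
  rewrite /thickness (_ : [set _ | _ in _] = [set delta]) ?inf1 //.
  apply/seteqP; split=> [_ [H' sH' <-]|_ ->] /=; first exact: wW.
  by exists H => //; exact: wW.
rewrite tW; apply: le_lt_trans (thickness_le cbZ sJ) _.
rewrite (width_height cbZ sJ iJ Zg gmax) dE; apply: height_dist_lt g0 _.
have /andP[a0 as_] := Zm g Zg; have := hform_cs p g m.
rewrite (lformC m p) pm mm !lformE; have := hform_le_m1 g p.
move: (lform g m) (lform g p) a0 as_ => a b a0 as_ b1 ab.
(* the height over the moved hyperplane is at most the height [a] over the first
   one: with [j = k' * - t'] one has [k' ^+ 2 - j ^+ 2 = 1] and [a <= - b], so
   [(k' - 1) * a <= j * - b] *)
have j0 : 0 <= k' * - t' by rewrite mulr_ge0 //; lra.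
have k'1 : 1 <= k' by nra.
have jk : k' - 1 <= k' * - t' by nra.
have aB : a <= - b by nra.
have : (k' - 1) * a <= k' * - t' * - b by apply: ler_pM => //; lra.
lra.
Qed.
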